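(* Let $\Gamma$ be a finite simple connected graph on $n$ vertices with spectrum $\{\lambda_0^{m_0},\lambda_1^{m_1},\ldots,\lambda_d^{m_d}\}$, $\lambda_0>\lambda_1>\cdots>\lambda_d$, and let $p_0,p_1,\ldots,p_d$ be its predistance polynomials, with $\omega_i^j$ being the coefficient of $x^j$ in $p_i$. Then: (a) The different eigenvalues $\lambda_i\neq\lambda_0$ of $\Gamma$ are the $d$ distinct zeros of the polynomial $H=p_0+p_1+\cdots+p_d$. (b) If $d\ge 2$, the largest eigenvalue (spectral radius) is $$\lambda_0=-\frac{\omega_1^1\,\omega_2^0}{\omega_2^2}.$$ (c) The multiplicity of each eigenvalue $\lambda_i$, for $i=0,\ldots,d$, is $$m_i=n\left(\sum_{j=0}^d\frac{p_j(\lambda_i)^2}{p_j(\lambda_0)}\right)^{-1}.$$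
   Context: The spectrum of a graph $\Gamma$ with adjacency matrix $A$ is the set of distinct eigenvalues $\lambda_0>\lambda_1>\cdots>\lambda_d$ of $A$ together with their multiplicities $m_0,\ldots,m_d$; so $d+1$ is the number of distinct eigenvalues, and $m_0=1$ since $\Gamma$ is connected. The predistance polynomials $p_0,\ldots,p_d\in\mathbb{R}[x]$ are the unique polynomials with $\deg p_i=i$ that are orthogonal with respect to the scalar product $\langle f,g\rangle_\Gamma=\frac1n\operatorname{tr}(f(A)g(A))=\frac1n\sum_{i=0}^d m_i f(\lambda_i)g(\lambda_i)$ on polynomials of degree at most $d$, normalized so that $\|p_i\|_\Gamma^2=p_i(\lambda_0)$ (it is known that $p_i(\lambda_0)>0$ for this normalization to make sense). The polynomial $H=p_0+\cdots+p_d$ is called the Hoffman polynomial of $\Gamma$. *)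

(* Defs.v *)
From mathcomp Require Import all_boot all_order all_algebra.

Set Implicit Arguments.
Unset Strict Implicit.
Unset Printing Implicit Defensive.

Import Order.TTheory GRing.Theory Num.Theory.

Local Open Scope ring_scope.

Definition simple_graph (T : finType) (e : rel T) : Prop :=
  symmetric e /\ irreflexive e.

(* The graph without vertices is not connected. *)
Definition connected_graph (T : finType) (e : rel T) : Prop :=
  (0 < #|T|)%N /\ forall x y : T, connect e x y.

Definition adjmx (R : nzRingType) (T : finType) (e : rel T) : 'M[R]_#|T| :=
  \matrix_(i, j) (e (enum_val i) (enum_val j))%:R.

(* [lam] lists the distinct eigenvalues of [A] in decreasing order and [m] gives
   their multiplicities as roots of the characteristic polynomial. *)
Definition is_spectrum (R : rcfType) (n : nat) (A : 'M[R]_n) (d : nat)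
    (lam : 'I_d.+1 -> R) (m : 'I_d.+1 -> nat) : Prop :=
  [/\ forall i j : 'I_d.+1, (i < j)%N -> lam j < lam i,
      forall a : R, eigenvalue A a <-> exists i, a = lam i
    & forall i, m i = mup (lam i) (char_poly A)].

(* [horner_mx] is only available when the size of the matrix is syntactically a
   successor, which [#|T|] is not; see [mx_evalE]. *)
Definition mx_eval (R : comNzRingType) (n : nat) (A : 'M[R]_n) (f : {poly R})
    : 'M[R]_n :=
  \sum_(k < size f) f`_k *: A ^+ k.

Lemma mx_evalE (R : comNzRingType) (n : nat) (A : 'M[R]_n.+1) (f : {poly R}) :
  mx_eval A f = horner_mx A f.
Proof.
rewrite -{2}[f]coefK poly_def linear_sum /=; apply: eq_bigr => k _.
by rewrite linearZ /= rmorphXn /= horner_mx_X.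
Qed.

Definition spec_dot (R : rcfType) (n : nat) (A : 'M[R]_n) (f g : {poly R}) : R :=
  n%:R^-1 * \tr (mx_eval A f *m mx_eval A g).

(* [size (p i) = i.+1] says that [p i] has degree [i]. *)
Definition is_predistance (R : rcfType) (n : nat) (A : 'M[R]_n) (d : nat)
    (lam : 'I_d.+1 -> R) (p : 'I_d.+1 -> {poly R}) : Prop :=
  [/\ forall i, size (p i) = i.+1,
      forall i j, i != j -> spec_dot A (p i) (p j) = 0
    & forall i, spec_dot A (p i) (p i) = (p i).[lam ord0]].

(* Main.v *)
Require Import Defs.
From mathcomp Require Import all_boot all_order all_algebra.
From mathcomp Require Import complex ring.

(** A real symmetric matrix is diagonalizable with real eigenvalues, so the
    trace form is a weighted sum over the spectrum,
      <f, g> = sum_i (m_i / n) f(lambda_i) g(lambda_i)   ([spec_dot_spectrum]).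
    Hence the orthogonality of the predistance polynomials says that the square
    matrix Q = (p_j(lambda_i)) satisfies Q W Q^T = D, where
    W = diag (m_i / n) and D = diag (p_j(lambda_0)). The entries of D are
    nonzero, because a nonzero polynomial of degree at most d cannot vanish at
    all d + 1 eigenvalues ([predistance_lam0_neq0]). A one-sided inverse of a
    square matrix is two-sided, so W Q^T D^-1 Q = 1 as well
    ([predistance_kernel]):
      (m_k / n) sum_j p_j(lambda_k) p_j(lambda_l) / p_j(lambda_0) = [k = l].
    The diagonal entries k = l are the multiplicity formula. In the row k = 0
    the factor p_j(lambda_0) cancels and the sum becomes H(lambda_l), so H
    vanishes at each lambda_l with l <> 0; as H has degree d, it has no other
    roots.

    The formula for lambda_0 comes from the moments of the spectrum up to order
    two, [predistance_spectral_radius]. The first moment is tr A / n = 0, as a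
    simple graph has no loops; let s = tr A^2 / n. The normalization gives
    p_0 = 1; p_1 orthogonal to p_0 gives p_1 = omega_1^1 x; the norm of p_1
    gives omega_1^1 s = lambda_0; and p_2 orthogonal to p_0 gives
    omega_2^0 = - omega_2^2 s. Eliminating s proves the claim. *)

Set Implicit Arguments.
Unset Strict Implicit.
Unset Printing Implicit Defensive.

Import Order.TTheory GRing.Theory Num.Theory.

Local Open Scope ring_scope.

(** * Spectrum of a real symmetric matrix *)

Lemma char_poly_uconjC (F : fieldType) n (P A : 'M[F]_n) :
  P \in unitmx -> char_poly (invmx P *m A *m P) = char_poly A.
Proof.
move=> Punit; pose P' := map_mx (@polyC F) P.
pose V' := map_mx (@polyC F) (invmx P).
have VP1 : V' *m P' = 1%:M by rewrite -map_mxM mulVmx // map_mx1.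
have conjE : char_poly_mx (invmx P *m A *m P) = V' *m char_poly_mx A *m P'.
  rewrite /char_poly_mx !map_mxM -/P' -/V' mulmxBr mulmxBl.
  by rewrite scalar_mxC -[_ *m V' *m P']mulmxA VP1 mulmx1.
rewrite /char_poly conjE -mulmxA det_mulmx det_mulmx mulrCA -det_mulmx.
by rewrite VP1 det1 mulr1.
Qed.

(** The spectral theorem holds over the algebraically closed field [R[i]], where a
    real symmetric matrix is Hermitian. Its eigenvalues there are real, so both
    identities descend to [R] along the injection of [R] into [R[i]]. *)
Lemma symmetric_spectrum (R : rcfType) n (A : 'M[R]_n.+1) : A^T = A ->
  exists r : 'I_n.+1 -> R, char_poly A = \prod_k ('X - (r k)%:P)
    /\ forall f, \tr (horner_mx A f) = \sum_k f.[r k].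
Proof.
move=> Asym; pose B := map_mx (real_complex R) A.
have Bherm : B \is hermsymmx.
  apply: realsym_hermsym.
    apply/is_hermitianmxP; rewrite expr0 scale1r; apply/matrixP => i j.
    by rewrite !mxE -[in LHS]Asym mxE.
  by apply/mxOverP => i j; rewrite mxE complex_real.
have [P [D [Punit BE Dreal]]] : exists P D,
    [/\ P \in unitmx, B = invmx P *m diag_mx D *m P & D \is a mxOver Num.real].
  exists (spectralmx B), (spectral_diag B); split.
  - exact: spectral_unit.
  - exact/orthomx_spectralP/hermitian_normalmx.
  - exact: hermitian_spectral_diag_real.
have DE k : D 0 k = (complex.Re (D 0 k))%:C%C.
  by rewrite RRe_real //; move/mxOverP: Dreal.
exists (fun k => complex.Re (D 0 k)); split=> [|f].
  apply: (map_poly_inj (real_complex R)).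
  rewrite map_char_poly -/B BE char_poly_uconjC // char_poly_trig.
    rewrite rmorph_prod; apply: eq_bigr => k _.
    by rewrite rmorphB /= map_polyX map_polyC /= -DE !mxE eqxx.
  by apply/is_trig_mxP => i j ij; rewrite mxE -val_eqE ltn_eqF.
apply: (fmorph_inj (real_complex R)).
rewrite -trace_map_mx map_horner_mx -/B BE horner_mx_uconjC //.
rewrite mxtrace_mulC mulmxA mulmxV // mul1mx horner_mx_diag mxtrace_diag.
by rewrite rmorph_sum; apply: eq_bigr => k _; rewrite /= mxE DE horner_map.
Qed.

(** The case analysis on the size makes [horner_mx] available, and with it the
    multiplicativity of polynomial evaluation at a matrix. *)
Lemma spec_dot_symmetric (R : rcfType) n (A : 'M[R]_n) :
    (0 < n)%N -> A^T = A ->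
  exists r : 'I_n -> R,
    [/\ char_poly A = \prod_k ('X - (r k)%:P), \tr A = \sum_k r k
      & forall f g, spec_dot A f g = n%:R^-1 * \sum_k f.[r k] * g.[r k]].
Proof.
case: n A => // n A _ /symmetric_spectrum[r [chA trA]]; exists r; split=> //.
  rewrite -[A in LHS]horner_mx_X trA.
  by apply: eq_bigr => k _; rewrite hornerX.
move=> f g; rewrite /spec_dot !mx_evalE; congr (_ * _).
rewrite [_ *m _](_ : _ = horner_mx A (f * g)); last by rewrite rmorphM.
by rewrite trA; apply: eq_bigr => k _; rewrite hornerM.
Qed.

Lemma mup_prod_XsubC (F : fieldType) (I : finType) (r : I -> F) x :
  mup x (\prod_k ('X - (r k)%:P)) = (\sum_k (r k == x))%N.
Proof.
elim: (index_enum I) => [|k s IHs]; first by rewrite !big_nil mupNroot ?root1.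
rewrite !big_cons mupM ?IHs ?polyXsubC_eq0 //; last first.
  by rewrite monic_neq0 ?monic_prod_XsubC.
by rewrite -['X - _]expr1 mup_XsubCX; case: eqP.
Qed.

Lemma spectrum_inj (R : rcfType) n (A : 'M[R]_n) d (lam : 'I_d.+1 -> R) m :
  is_spectrum A lam m -> injective lam.
Proof.
case=> lam_dec _ _ i j eq_lam; apply/val_inj/eqP.
by case: ltngtP => // /lam_dec; rewrite eq_lam ltxx.
Qed.

Lemma mult_gt0 (R : rcfType) n (A : 'M[R]_n) d (lam : 'I_d.+1 -> R) m i :
  is_spectrum A lam m -> (0 < m i)%N.
Proof.
case=> _ eigE ->; rewrite mup_geq ?expr1 ?dvdp_XsubCl.
  by rewrite -eigenvalue_root_char; apply/eigE; exists i.
by rewrite monic_neq0 ?char_poly_monic.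
Qed.

(** The coincidence of the algebraic multiplicity [m i] with the number of
    diagonal entries equal to [lam i] regroups the trace by distinct
    eigenvalues. *)
Lemma spec_dot_spectrum (R : rcfType) n (A : 'M[R]_n) d
    (lam : 'I_d.+1 -> R) m f g :
    (0 < n)%N -> A^T = A -> is_spectrum A lam m ->
  spec_dot A f g = \sum_i (m i)%:R / n%:R * (f.[lam i] * g.[lam i]).
Proof.
move=> n_gt0 Asym specA; have [_ eigE mE] := specA.
have [r [chA _ ->]] := spec_dot_symmetric n_gt0 Asym.
have r_lam k : exists i, r k = lam i.
  apply/eigE; rewrite eigenvalue_root_char chA rootE horner_prod.
  by apply/prodf_eq0; exists k; rewrite // hornerXsubC subrr.
transitivity (n%:R^-1 * \sum_i \sum_k (r k == lam i)%:R * (f.[r k] * g.[r k])).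
  congr (_ * _); rewrite exchange_big; apply: eq_bigr => k _ /=.
  have [i ri] := r_lam k; rewrite (bigD1 i) //= ri eqxx mul1r big1 ?addr0 //.
  by move=> j ji; rewrite (inj_eq (spectrum_inj specA)) eq_sym (negPf ji) mul0r.
rewrite big_distrr; apply: eq_bigr => i _ /=.
rewrite mE chA mup_prod_XsubC natr_sum mulrAC mulrC; congr (_ * _).
rewrite big_distrl; apply: eq_bigr => k _ /=.
by case: eqP => [->|]; rewrite ?mul0r.
Qed.

(** * Predistance polynomials *)

(** Orthogonality of the rows of a square matrix implies orthogonality of its
    columns. With [Q = (q i k)], the hypothesis says that
    [Q diag(w) Q^T diag(D)^-1 = 1]; the conclusion is the same identity with
    [Q] moved to the right end of the product. *)
Lemma dual_orthogonality (F : fieldType) N (w D : 'I_N -> F)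
    (q : 'I_N -> 'I_N -> F) :
    (forall i, D i != 0) ->
    (forall i j, \sum_k w k * (q i k * q j k) = if i == j then D i else 0) ->
  forall k l, w k * (\sum_j q j k * q j l / D j) = (k == l)%:R.
Proof.
move=> D0 orth k l.
pose Q := \matrix_(i, k) q i k; pose S := \matrix_(k, j) (w k * q j k / D j).
have QS : Q *m S = 1%:M.
  apply/matrixP => i j; rewrite !mxE.
  under eq_bigr do rewrite !mxE mulrA mulrCA.
  rewrite -big_distrl /= orth.
  by case: eqP => [->|_]; rewrite ?mul0r // divff.
have /matrixP/(_ k l) := mulmx1C QS; rewrite !mxE => <-.
rewrite big_distrr /=; apply: eq_bigr => j _; rewrite !mxE.
by ring.
Qed.

(** [(p i).[lam ord0]] is the squared norm of [p i], a sum of nonnegative terms.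
    If it were zero, [p i] would vanish at all [d.+1] eigenvalues, more than its
    degree allows. *)
Lemma predistance_lam0_neq0 (R : rcfType) n (A : 'M[R]_n) d
    (lam : 'I_d.+1 -> R) m p i :
    (0 < n)%N -> A^T = A -> is_spectrum A lam m -> is_predistance A lam p ->
  (p i).[lam ord0] != 0.
Proof.
move=> n_gt0 Asym specA [szp _ <-].
rewrite (spec_dot_spectrum _ _ n_gt0 Asym specA).
apply/negP; rewrite psumr_eq0 => [/allP p0|j _]; last first.
  by rewrite mulr_ge0 ?divr_ge0 ?ler0n // -expr2 sqr_ge0.
suff: false by []; have := @max_poly_roots _ (p i) (codom lam).
rewrite -size_poly_eq0 szp size_codom card_ord ltnS ltnNge leq_ord.
apply=> //; last exact/injectiveP/(spectrum_inj specA).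
apply/allP => _ /codomP[j ->]; have := p0 j (mem_index_enum j).
rewrite /= !mulf_eq0 invr_eq0 !pnatr_eq0 orbb.
by rewrite (gtn_eqF n_gt0) (gtn_eqF (mult_gt0 j specA)).
Qed.

(** In other words, the kernel of evaluation at [lam k], expanded in the
    orthogonal basis [p], is a multiple of the Lagrange polynomial of [lam k] on
    the spectrum. *)
Lemma predistance_kernel (R : rcfType) n (A : 'M[R]_n) d
    (lam : 'I_d.+1 -> R) m p :
    (0 < n)%N -> A^T = A -> is_spectrum A lam m -> is_predistance A lam p ->
  forall k l, (m k)%:R / n%:R *
    (\sum_j (p j).[lam k] * (p j).[lam l] / (p j).[lam ord0]) = (k == l)%:R.
Proof.
move=> n_gt0 Asym specA predA; have [_ orth normp] := predA.
apply: (dual_orthogonality (D := fun j => (p j).[lam ord0])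
                           (q := fun j k => (p j).[lam k])).
  by move=> j; exact: (predistance_lam0_neq0 j n_gt0 Asym specA predA).
move=> i j; rewrite -(spec_dot_spectrum _ _ n_gt0 Asym specA).
by have [<-|/orth] := eqVneq.
Qed.

Lemma size_predistance_sum (R : nzRingType) d (p : 'I_d.+1 -> {poly R}) :
  (forall i, size (p i) = i.+1) -> size (\sum_i p i) = d.+1.
Proof.
move=> szp; rewrite big_ord_recr /= addrC size_polyDl !szp //= ltnS.
apply: leq_trans (size_sum _ _ _) _; apply/bigmax_leqP => i _.
by rewrite szp /=.
Qed.

(** The Hoffman polynomial is the kernel of evaluation at [lam ord0], since there
    the coefficient of [p j] is [(p j).[lam ord0] / (p j).[lam ord0] = 1]. *)
Lemma predistance_sum_root (R : rcfType) n (A : 'M[R]_n) d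
    (lam : 'I_d.+1 -> R) m p l :
    (0 < n)%N -> A^T = A -> is_spectrum A lam m -> is_predistance A lam p ->
  l != ord0 -> root (\sum_i p i) (lam l).
Proof.
move=> n_gt0 Asym specA predA l0.
have /eqP := predistance_kernel n_gt0 Asym specA predA ord0 l.
rewrite [ord0 == l]eq_sym (negPf l0) !mulf_eq0 invr_eq0 !pnatr_eq0.
rewrite (gtn_eqF n_gt0) (gtn_eqF (mult_gt0 ord0 specA)) /= rootE horner_sum.
congr (_ == 0); apply: eq_bigr => j _.
rewrite mulrAC divff ?mul1r //.
exact: (predistance_lam0_neq0 j n_gt0 Asym specA predA).
Qed.

(** With vanishing trace, the average over the spectrum of a quadratic polynomial
    only sees its constant and its leading coefficient; this determines the
    ratio of [(p (inord 2))`_0] to [(p (inord 2))`_2] and ties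
    [(p (inord 1))`_1] to [lam ord0] through the same second moment. *)
Lemma predistance_spectral_radius (R : rcfType) n (A : 'M[R]_n) d
    (lam : 'I_d.+1 -> R) p :
    (0 < n)%N -> A^T = A -> \tr A = 0 -> is_predistance A lam p ->
  (2 <= d)%N ->
  lam ord0 = - (((p (inord 1))`_1 * (p (inord 2))`_0) / (p (inord 2))`_2).
Proof.
move=> n_gt0 Asym trA [szp orth normp] d2.
have [r [_ trAr dotE]] := spec_dot_symmetric n_gt0 Asym.
have n0 : n%:R != 0 :> R by rewrite pnatr_eq0 -lt0n.
have d1 := ltnW d2.
pose s := n%:R^-1 * \sum_k r k ^+ 2.
pose p1 := p (inord 1); pose p2 := p (inord 2).
have sz1 : size p1 = 2 by rewrite szp inordK.
have sz2 : size p2 = 3 by rewrite szp inordK.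
have meanE a b c :
    n%:R^-1 * \sum_k (a + b * r k + c * r k ^+ 2) = a + c * s.
  rewrite !big_split /= -!big_distrr /= -trAr trA sumr_const card_ord.
  by rewrite -[a *+ n]mulr_natr /s; field.
have p0E x : (p ord0).[x] = 1.
  have /size_poly1P[c c0 pc] : size (p ord0) == 1%N by rewrite szp.
  have := normp ord0; rewrite dotE pc !hornerC.
  under eq_bigr do rewrite hornerC.
  rewrite sumr_const card_ord -[(c * c) *+ n]mulr_natl mulKf //.
  by rewrite -[RHS]mulr1 => /(mulfI c0).
have p1E x : p1.[x] = p1`_0 + p1`_1 * x.
  by rewrite horner_coef sz1 !big_ord_recl big_ord0 /= expr0 expr1 mulr1 addr0.
have p2E x : p2.[x] = p2`_0 + p2`_1 * x + p2`_2 * x ^+ 2.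
  rewrite horner_coef sz2 !big_ord_recl big_ord0 /= expr0 expr1 mulr1 addr0.
  by rewrite addrA.
have i1 : inord 1 != ord0 :> 'I_d.+1 by rewrite -val_eqE /= inordK.
have i2 : inord 2 != ord0 :> 'I_d.+1 by rewrite -val_eqE /= inordK.
have p1_0 : p1`_0 = 0.
  have := meanE p1`_0 p1`_1 0; rewrite mul0r addr0 => <-.
  rewrite -[RHS](orth _ _ i1) dotE; congr (_ * _).
  by apply: eq_bigr => k _; rewrite p0E p1E mulr1 mul0r addr0.
have p2_0 : p2`_0 = - (p2`_2 * s).
  apply/eqP; rewrite -addr_eq0 -(meanE _ p2`_1); apply/eqP.
  rewrite -[RHS](orth _ _ i2) dotE; congr (_ * _); apply: eq_bigr => k _.
  by rewrite p0E p2E mulr1.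
have p2_2 : p2`_2 != 0.
  by have := lead_coef_eq0 p2; rewrite lead_coefE sz2 /= -size_poly_eq0 sz2 => ->.
have p1_1 : p1`_1 != 0.
  by have := lead_coef_eq0 p1; rewrite lead_coefE sz1 /= -size_poly_eq0 sz1 => ->.
have lam0E : lam ord0 = p1`_1 * s.
  apply: (mulfI p1_1); have := normp (inord 1).
  rewrite -/p1 p1E p1_0 add0r => <-; rewrite dotE mulrA -[RHS]add0r.
  rewrite -(meanE 0 0); congr (_ * _); apply: eq_bigr => k _.
  by rewrite p1E p1_0; ring.
by rewrite lam0E p2_0; field.
Qed.

(** * Graphs *)

Lemma adjmx_sym (R : nzRingType) (T : finType) (e : rel T) :
  symmetric e -> (adjmx R e)^T = adjmx R e.
Proof. by move=> esym; apply/matrixP => i j; rewrite !mxE esym. Qed.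

Lemma tr_adjmx (R : nzRingType) (T : finType) (e : rel T) :
  irreflexive e -> \tr (adjmx R e) = 0.
Proof. by move=> eirr; apply: big1 => i _; rewrite mxE eirr. Qed.

Theorem proposition3p1 (R : rcfType) (T : finType) (e : rel T)
    (he : simple_graph e) (hconn : connected_graph e)
    (d : nat) (lam : 'I_d.+1 -> R) (m : 'I_d.+1 -> nat)
    (hspec : is_spectrum (adjmx R e) lam m)
    (p : 'I_d.+1 -> {poly R}) (hp : is_predistance (adjmx R e) lam p) :
  [/\ (* (a) *)
      let zs := [seq x <- codom lam | x != lam ord0] in
      [/\ uniq zs, size zs = d
        & forall x : R, root (\sum_(i < d.+1) p i) x = (x \in zs)],
      (* (b) *)
      (2 <= d)%N ->
      lam ord0
      = - (((p (inord 1))`_1 * (p (inord 2))`_0) / (p (inord 2))`_2)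
    & (* (c) *)
      forall i : 'I_d.+1,
        (m i)%:R
        = #|T|%:R * (\sum_(j < d.+1) (p j).[lam i] ^+ 2 / (p j).[lam ord0])^-1].
Proof.
have [esym eirr] := he; have [n_gt0 _] := hconn.
have Asym := adjmx_sym R esym.
have n0 : #|T|%:R != 0 :> R by rewrite pnatr_eq0 -lt0n.
have lam_inj := spectrum_inj hspec.
split; last 1 first.
- move=> i; have := predistance_kernel n_gt0 Asym hspec hp i i.
  rewrite eqxx mulrAC -mulrA => kerE.
  under eq_bigr do rewrite expr2.
  set S := \sum_(j < _) _ in kerE *.
  have S0 : S != 0.
    by apply/eqP => S0; move/eqP: kerE; rewrite S0 mul0r mulr0 eq_sym oner_eq0.
  apply: (mulIf S0); rewrite mulfVK //.
  by apply: (mulIf (invr_neq0 n0)); rewrite divff // -mulrA.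
- have lam_uniq : uniq (codom lam) by apply/injectiveP.
  move=> zs; have zs_uniq : uniq zs by rewrite filter_uniq.
  have sz_zs : size zs = d.
    have := rem_filter (lam ord0) lam_uniq; rewrite /zs => <-.
    by rewrite size_rem ?codom_f // size_codom card_ord.
  split=> // x; apply/idP/idP => [Hx|]; last first.
    rewrite mem_filter => /andP[x0 /codomP[l xl]]; rewrite xl in x0 *.
    apply: predistance_sum_root hspec hp _ => //.
    by apply: contraNneq x0 => ->.
  have [szp _ _] := hp.
  (* A further root would give [H], of degree [d], at least [d.+1] roots. *)
  apply: contraT => x_zs; have := @max_poly_roots _ (\sum_i p i) (x :: zs).
  rewrite -size_poly_eq0 size_predistance_sum //= x_zs sz_zs ltnn zs_uniq Hx.
  apply=> //; apply/allP => y; rewrite mem_filter => /andP[y0 /codomP[l yl]].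
  rewrite yl in y0 *; apply: predistance_sum_root hspec hp _ => //.
  by apply: contraNneq y0 => ->.
- exact: (predistance_spectral_radius n_gt0 Asym (tr_adjmx R eirr) hp).
Qed.
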